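(* Let $M\subset\mathbb{M}^n(C)$ be a nontrivial concircular hypersurface with axis $V$ and unit normal vector field $N$, put $\lambda=\langle V,N\rangle$ (a constant), and decompose $V|_M=\alpha T+\lambda N$, where $T$ is a unit vector field tangent to $M$ and $\alpha$ is a differentiable function on $M$ with $\alpha\neq 0$. Then the integral curves of $T$ are geodesics in $\mathbb{M}^n(C)$.
   Context: Let $C\neq 0$ be real, $n\ge 2$, and write $C=\varepsilon/R^2$ with $R>0$, $\varepsilon=(-1)^\nu$, $\nu\in\{0,1\}$. $\mathbb{R}^{n+1}_\nu$ is $\mathbb{R}^{n+1}$ with the flat metric $\langle\,,\rangle=\varepsilon\,dx_1^2+dx_2^2+\cdots+dx_{n+1}^2$. $\mathbb{M}^n(C)=\{p\in\mathbb{R}^{n+1}_\nu:\langle p,p\rangle=1/C\}$ (the sheet $x_1>0$ if $C<0$), with the induced metric, is the sphere or hyperbolic space of constant curvature $C$, with Levi-Civita connection $\overline\nabla$. A vector field $V$ on $\mathbb{M}^n(C)$ is concircular if $\overline\nabla_XV=\mu X$ for all tangent $X$, for some smooth function $\mu$ on $\mathbb{M}^n(C)$. A hypersurface $M\subset\mathbb{M}^n(C)$ with unit normal vector field $N$ is concircular with axis $V$ if $V$ is a concircular vector field on $\mathbb{M}^n(C)$ such that $\langle N,V\rangle$ is constant along $M$. It is nontrivial if it is not a totally umbilical hypersurface of $\mathbb{M}^n(C)$. The condition $\alpha\neq0$ means that $\alpha$ vanishes nowhere on $M$. *)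

(* Defs.v *)
From HB Require Import structures.
From mathcomp Require Export all_boot all_order all_algebra.
From mathcomp Require Export all_classical all_reals all_analysis.

Set Implicit Arguments.
Unset Strict Implicit.
Unset Printing Implicit Defensive.

Import Order.TTheory GRing.Theory Num.Theory numFieldNormedType.Exports.

Local Open Scope classical_set_scope.
Local Open Scope ring_scope.

Section Smooth.
Context {R : realType} {E W : normedModType R}.

(* D_{v_1} (D_{v_2} (... (D_{v_k} f))) for s = [:: v_1; ...; v_k]. *)
Definition iterated_derive (f : E -> W) (s : seq E) : E -> W :=
  foldr (fun v g x => 'D_v g x) f s.

(* C^oo on U, to be used with U open: ['D_v] at a point only depends on the
   germ there, so the values of f outside U are irrelevant. *)
Definition smooth_on (U : set E) (f : E -> W) : Prop :=
  forall (s : seq E) (x : E), U x -> differentiable (iterated_derive f s) x.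

Definition smooth_extension (S : set E) (f : E -> W) (p : E) (g : E -> W)
    : Prop :=
  exists U : set E,
    [/\ open U, U p, smooth_on U g & forall x, U x -> S x -> g x = f x].

(* Smoothness of f restricted to a (not necessarily open) set S; only the
   values of f on S matter. *)
Definition smooth_in (S : set E) (f : E -> W) : Prop :=
  forall p, S p -> exists g, smooth_extension S f p g.

End Smooth.

Section SpaceForm.
Context {R : realType} {n : nat}.
Variable C : R.
Local Notation E := 'rV[R]_n.+1.

(* The sign eps of C = eps / R^2 is [Num.sg C]; the coordinate x_1 is the one
   of index 0. *)
Definition sform (x y : E) : R :=
  Num.sg C * (x ord0 ord0 * y ord0 ord0)
  + \sum_(j < n) x ord0 (lift ord0 j) * y ord0 (lift ord0 j).

Definition space_form : set E :=
  [set p | sform p p = C^-1 /\ (C < 0 -> 0 < p ord0 ord0)].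

(* The tangent space at p is the orthogonal complement of p. *)
Definition space_form_tangent (p : E) : set E := [set X | sform p X = 0].

(* Orthogonal projection onto the tangent space at p (recall <p, p> = 1/C).
   Applied to flat derivatives of tangent fields it yields the Levi-Civita
   connection of the space form. *)
Definition tproj (p w : E) : E := w - (C * sform w p) *: p.

(* [is_cov_derive V p X Y] : the covariant derivative of V along X at p is Y.
   For X tangent at p the choice of the extension g is immaterial. *)
Definition is_cov_derive (V : E -> E) (p X Y : E) : Prop :=
  exists2 g, smooth_extension space_form V p g & tproj p ('D_X g p) = Y.

Definition concircular (V : E -> E) : Prop :=
  [/\ smooth_in space_form V,
      forall p, space_form p -> space_form_tangent p (V p)
    & exists2 mu : E -> R, smooth_in space_form mu &
        forall p X, space_form p -> space_form_tangent p X ->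
          is_cov_derive V p X (mu p *: X)].

Definition geodesic (I : set R) (c : R -> E) : Prop :=
  [/\ smooth_on I c,
      forall t, I t -> space_form (c t)
    & forall t, I t -> tproj (c t) (derive1 (derive1 c) t) = 0].

End SpaceForm.

(* Immersed hypersurfaces i : M -> M^n(C); embedded ones are the case where M is
   a subspace of M^n(C) and i is the inclusion. The parametrizations below are
   homeomorphisms phi from an open set onto an open subset of M for which
   i \o phi is a smooth immersion. Changes of parametrization are then
   automatically smooth, so the parametrizations are the (inverse) charts of the
   unique smooth structure of M for which i is an immersion, and no atlas has to
   be given as extra data. *)
Section Hypersurface.
Context {R : realType} {n : nat}.
Variable C : R.
Local Notation E := 'rV[R]_n.+1.
Local Notation H := 'rV[R]_n.-1.
Context {M : topologicalType}.
Variable i : M -> E.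

Definition parametrization (U : set H) (phi : H -> M) : Prop :=
  [/\ open U,
      {in U &, injective phi},
      (forall u, U u -> {for u, continuous phi}) /\
      (forall O, open O -> O `<=` U -> open (phi @` O)),
      smooth_on U (i \o phi)
    & forall u xi, U u -> 'D_xi (i \o phi) u = 0 -> xi = 0].

Definition immersed_hypersurface : Prop :=
  [/\ hausdorff_space M,
      @second_countable M,
      forall m, space_form C (i m)
    & forall m, exists U phi, parametrization U phi /\ (phi @` U) m].

Definition smooth_map {W : normedModType R} (f : M -> W) : Prop :=
  forall U phi, parametrization U phi -> smooth_on U (f \o phi).

(* X, seen in R^{n+1} through the differential of i, is tangent to M at m. *)
Definition tangent_at (m : M) (X : E) : Prop :=
  exists U phi u xi,
    [/\ parametrization U phi, U u, phi u = m & 'D_xi (i \o phi) u = X].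

Definition unit_normal (N : M -> E) : Prop :=
  [/\ smooth_map N,
      forall m, space_form_tangent C (i m) (N m),
      forall m X, tangent_at m X -> sform C (N m) X = 0
    & forall m, sform C (N m) (N m) = 1].

(* [shape phi N u xi] : the shape operator A X = - nabla_X N at phi u, for
   X = d(i \o phi)_u(xi). *)
Definition shape (phi : H -> M) (N : M -> E) (u xi : H) : E :=
  - tproj C (i (phi u)) ('D_xi (N \o phi) u).

Definition totally_umbilical (N : M -> E) : Prop :=
  exists rho : M -> R, forall U phi, parametrization U phi ->
    forall u xi, U u -> shape phi N u xi = rho (phi u) *: 'D_xi (i \o phi) u.

Definition concircular_hypersurface (N : M -> E) (V : E -> E) : Prop :=
  [/\ immersed_hypersurface, unit_normal N, concircular C V
    & exists k : R, forall m, sform C (N m) (V (i m)) = k].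

Definition differentiable_curve_at (gamma : R -> M) (t : R) : Prop :=
  exists U phi (c : R -> H),
    [/\ parametrization U phi, U (c t), derivable c t 1
      & \forall s \near t, gamma s = phi (c s)].

Definition integral_curve (T : M -> E) (I : set R) (gamma : R -> M) : Prop :=
  [/\ open I, is_interval I
    & forall t, I t ->
        differentiable_curve_at gamma t /\ derive1 (i \o gamma) t = T (gamma t)].

End Hypersurface.

(* Main.v *)
Require Import Defs.
From mathcomp Require Import ring.
Import Order.TTheory GRing.Theory Num.Theory numFieldNormedType.Exports.

(* Write A X = - nabla_X N for the shape operator. Differentiating the constant
   <V, N> along a tangent X, and using nabla_X V = mu X, gives
   alpha <T, A X> = 0; as A is self-adjoint and the tangent space of M together
   with N and the position vector spans R^{n+1}, A T = 0. Hence differentiating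
   V = alpha T + lambda N along T leaves mu T = T(alpha) T + alpha nabla_T T, and
   nabla_T T, being orthogonal to the unit field T, vanishes.
   An integral curve c of T is only assumed differentiable; its smoothness comes
   from the geodesic equation itself, which reads c'' = - C c because |c'| = 1. *)

Set Implicit Arguments.
Unset Strict Implicit.
Unset Printing Implicit Defensive.

Local Open Scope classical_set_scope.
Local Open Scope ring_scope.

Lemma near_open (S : topologicalType) (U : set S) u :
  open U -> U u -> \forall y \near u, U y.
Proof. by rewrite openE; apply. Qed.

(** * Symmetry of second directional derivatives *)

Section MixedDerivatives.
Context {R : realType} {V : normedModType R}.
Implicit Types a x v w : V.

Lemma is_derive_line {W : normedModType R} (f : V -> W) a v (t : R) df :
  is_derive (a + t *: v) v f df ->
  is_derive t 1 (fun s : R => f (a + s *: v)) df.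
Proof.
move=> [fd <-]; suff E : (fun h : R => h^-1 *:
    (((fun s : R => f (a + s *: v)) \o shift t) (h *: 1) - f (a + t *: v)))
  = (fun h : R => h^-1 *: ((f \o shift (a + t *: v)) (h *: v) - f (a + t *: v))).
  by apply: DeriveDef; rewrite /derivable /derive E.
apply/funext => h /=; congr (_ *: (f _ - _)).
by rewrite -[h *: 1]/(h * 1) mulr1 scalerDl addrCA.
Qed.

Lemma MVT_line (f df : V -> R) a v (h : R) : 0 < h ->
  (forall t, 0 <= t <= h -> is_derive (a + t *: v) v f (df (a + t *: v))) ->
  exists2 t, 0 <= t <= h & f (a + h *: v) - f a = h * df (a + t *: v).
Proof.
move=> h0 fD.
have lineD t (ht : 0 <= t <= h) := is_derive_line (fD t ht).
have [|t] := @MVT _ (fun s : R => f (a + s *: v)) _ _ _ h0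
    (fun t ht => lineD t (subset_itv_oo_cc ht)).
  by apply: derivable_within_continuous => t; rewrite in_itv /= => /lineD [].
move=> /subset_itv_oo_cc ht; rewrite scale0r addr0 subr0 => ->.
by exists t => //; rewrite mulrC.
Qed.

(** The mean value theorem is applied twice: in direction [v] to the difference
    [f (y + h *: w) - f y], which produces [t], then in direction [w] to [fv] from the point
    [x + t *: v], which produces [s]. *)
Lemma second_difference (f fv fvw : V -> R) x v w (h : R) : 0 < h ->
  (forall t s, 0 <= t <= h -> 0 <= s <= h ->
     is_derive (x + t *: v + s *: w) v f (fv (x + t *: v + s *: w))) ->
  (forall t s, 0 <= t <= h -> 0 <= s <= h ->
     is_derive (x + t *: v + s *: w) w fv (fvw (x + t *: v + s *: w))) ->
  exists t s, [/\ 0 <= t <= h, 0 <= s <= h &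
    f (x + h *: v + h *: w) - f (x + h *: v) - (f (x + h *: w) - f x)
    = h ^+ 2 * fvw (x + t *: v + s *: w)].
Proof.
move=> h0 fD fvD.
have h00 : 0 <= (0 : R) <= h by rewrite lexx ltW.
have hh : 0 <= h <= h by rewrite lexx ltW.
have gD t : 0 <= t <= h ->
    is_derive (x + t *: v) v (fun y => f (y + h *: w) - f y)
      (fv (x + t *: v + h *: w) - fv (x + t *: v)).
  move=> ht; have := fD _ _ ht h00; rewrite scale0r addr0 => d0.
  have [d1 e1] := fD _ _ ht hh.
  apply: (@is_deriveB _ _ _ (fun y => f (y + h *: w)) f).
  suff E : (fun r : R => r^-1 *: (((fun y => f (y + h *: w)) \o shift (x + t *: v))
      (r *: v) - f (x + t *: v + h *: w)))
    = (fun r : R => r^-1 *: ((f \o shift (x + t *: v + h *: w)) (r *: v)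
      - f (x + t *: v + h *: w))).
    by apply: DeriveDef; [move: d1|]; rewrite /derivable /derive E.
  by apply/funext => r /=; rewrite !addrA.
have [t ht ->] := MVT_line (df := fun y => fv (y + h *: w) - fv y) h0 gD.
have [s hs ->] := MVT_line h0 (fun s => fvD t s ht).
by exists t, s; split => //; rewrite mulrA expr2.
Qed.

(* Both mixed partials are limits of the same second difference quotient. *)
Lemma mixed_derive_comm (f fv fw fvw fwv : V -> R) x v w :
  (\forall y \near x, is_derive y v f (fv y)) ->
  (\forall y \near x, is_derive y w f (fw y)) ->
  (\forall y \near x, is_derive y w fv (fvw y)) ->
  (\forall y \near x, is_derive y v fw (fwv y)) ->
  {for x, continuous fvw} -> {for x, continuous fwv} -> fvw x = fwv x.
Proof.
move=> fvD fwD fvwD fwvD cvw cwv; apply/eqP; rewrite -subr_eq0 -normr_le0.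
apply/ler_addgt0Pl => e e0; rewrite addr0.
have e2 : 0 < e / 2 by rewrite divr_gt0.
move/cvgrPdist_lt: cvw => /(_ _ e2) cvw; move/cvgrPdist_lt: cwv => /(_ _ e2) cwv.
have [r /= r0 hr] := (nbhs_ballP _ _).1
  (filterI fvD (filterI fwD (filterI fvwD (filterI fwvD (filterI cvw cwv))))).
have k0 : 0 < 1 + `|v| + `|w| by rewrite -addrA ltr_pwDl // addr_ge0.
(* The parallelogram with sides [h *: v] and [h *: w] must stay in the ball of radius [r]. The
   summand 1 keeps the denominator positive when [v] and [w] vanish, and the final halving makes the
   bound strict. *)
pose h := r / (1 + `|v| + `|w|) / 2.
have h0 : 0 < h by rewrite !divr_gt0.
have inb t s : 0 <= t <= h -> 0 <= s <= h -> ball x r (x + t *: v + s *: w).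
  move=> /andP[t0 th] /andP[s0 sh].
  rewrite -ball_normE /ball_ /= -addrA opprD addNKr normrN.
  apply: le_lt_trans (ler_normD _ _) _; rewrite !normrZ !ger0_norm //.
  apply: (@le_lt_trans _ _ (h * (1 + `|v| + `|w|))).
    rewrite !mulrDr lerD // ?ler_wpM2r //.
    by apply: le_trans (ler_wpM2r _ th) _ => //; rewrite lerDr mulr1 ltW.
  by rewrite /h mulrAC divfK ?gt_eqF // ltr_pdivrMr // ltr_pMr // ltr1n.
have inb' t s : 0 <= t <= h -> 0 <= s <= h -> ball x r (x + t *: w + s *: v).
  by move=> ht hs; rewrite addrAC; exact: inb.
have [t [s [ht hs E1]]] := second_difference h0
  (fun t s ht hs => (hr _ (inb t s ht hs)).1)
  (fun t s ht hs => (hr _ (inb t s ht hs)).2.2.1).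
have [t' [s' [ht' hs' E2]]] := second_difference h0
  (fun t s ht hs => (hr _ (inb' t s ht hs)).2.1)
  (fun t s ht hs => (hr _ (inb' t s ht hs)).2.2.2.1).
have E : fvw (x + t *: v + s *: w) = fwv (x + t' *: w + s' *: v).
  apply: (@mulfI _ (h ^+ 2)); first by rewrite expf_neq0 // gt_eqF.
  by rewrite -E1 -E2 [x + h *: w + _]addrAC; ring.
have [_ [_ [_ [_ [c1 _]]]]] := hr _ (inb _ _ ht hs).
have [_ [_ [_ [_ [_ c2]]]]] := hr _ (inb' _ _ ht' hs').
rewrite distrC in c2; rewrite -(subrKA (fvw (x + t *: v + s *: w))).
apply: le_trans (ler_normD _ _) _; rewrite [X in _ <= X](splitr e).
by apply: lerD; [exact: ltW c1|rewrite E; exact: ltW c2].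
Qed.

(** The mean value theorem as an equality holds for real values only, so the argument goes
    coordinate by coordinate; smoothness supplies the continuity of both mixed derivatives. *)
Lemma smooth_derive_comm (n : nat) (U : set V) (f : V -> 'rV[R]_n) x v w :
  open U -> smooth_on U f -> U x -> 'D_w ('D_v f) x = 'D_v ('D_w f) x.
Proof.
move=> oU fs Ux; apply/rowP => j.
have nU := near_open oU Ux.
have D (g : V -> 'rV[R]_n) y z : differentiable g y ->
    is_derive y z (fun y => g y ord0 j) ('D_z g y ord0 j).
  move=> /(@diff_derivable _ _ _ _ _ z) gd; rewrite derive_mx // mxE.
  exact/derivableP/(derivable_mxP _ _ _).1.
have ct (g : V -> 'rV[R]_n) : differentiable g x ->
    {for x, continuous (fun y => g y ord0 j)}.
  move=> gd; apply: differentiable_continuous.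
  exact: (differentiable_comp (g := fun M : 'rV[R]_n => M ord0 j) gd
    (differentiable_coord _ _ _)).
apply: (mixed_derive_comm (f := fun y => f y ord0 j)
  (fv := fun y => 'D_v f y ord0 j) (fw := fun y => 'D_w f y ord0 j)
  (fvw := fun y => 'D_w ('D_v f) y ord0 j)
  (fwv := fun y => 'D_v ('D_w f) y ord0 j) (x := x) (v := v) (w := w)).
- by apply: filterS nU => y Uy; apply: D; exact: (fs [::]).
- by apply: filterS nU => y Uy; apply: D; exact: (fs [::]).
- by apply: filterS nU => y Uy; apply: D; exact: (fs [:: v]).
- by apply: filterS nU => y Uy; apply: D; exact: (fs [:: w]).
- by apply: ct; exact: (fs [:: w; v]).
- by apply: ct; exact: (fs [:: v; w]).
Qed.

End MixedDerivatives.

(** * The ambient bilinear form and the tangential projection *)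

Section Sform.
Context {R : realType} {n : nat}.
Variable C : R.
Implicit Types (x y z p : 'rV[R]_n.+1) (k : R).

Lemma sformC x y : sform C x y = sform C y x.
Proof.
rewrite /sform [x _ _ * _]mulrC; congr (_ + _).
by apply: eq_bigr => j _; rewrite mulrC.
Qed.

Lemma sformDl x y z : sform C (x + y) z = sform C x z + sform C y z.
Proof.
rewrite /sform !mxE mulrDl mulrDr addrACA -big_split; congr (_ + _).
by apply: eq_bigr => j _; rewrite mxE mulrDl.
Qed.

Lemma sformZl k x y : sform C (k *: x) y = k * sform C x y.
Proof.
rewrite /sform !mxE -mulrA mulrCA mulrDr mulr_sumr; congr (_ + _).
by apply: eq_bigr => j _; rewrite mxE mulrA.
Qed.

Lemma sformBl x y z : sform C (x - y) z = sform C x z - sform C y z.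
Proof. by rewrite sformDl -scaleN1r sformZl mulN1r. Qed.

Lemma sformDr x y z : sform C x (y + z) = sform C x y + sform C x z.
Proof. by rewrite sformC sformDl !(sformC x). Qed.

Lemma sformZr k x y : sform C x (k *: y) = k * sform C x y.
Proof. by rewrite sformC sformZl sformC. Qed.

(** Pairing with the standard basis recovers every coordinate of [x], the one of index 0 up to the
    factor [Num.sg C], which is nonzero because [C] is. *)
Lemma sform_nondegenerate x :
  C != 0 -> (forall y, sform C x y = 0) -> x = 0.
Proof.
move=> C0 x0; apply/rowP => j; rewrite mxE.
have := x0 (delta_mx 0 j); rewrite /sform; case: (unliftP ord0 j) => [k|] ->.
  rewrite !mxE (negPf (neq_lift _ _)) andbF !mulr0 add0r.
  rewrite (bigD1 k) //= big1 => [|l lk]; first by rewrite mxE !eqxx mulr1 addr0.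
  by rewrite mxE (inj_eq lift_inj) (negPf lk) mulr0.
rewrite big1 => [|l _]; last first.
  by rewrite mxE [lift _ _ == _]eq_sym (negPf (neq_lift _ _)) andbF mulr0.
rewrite !mxE !eqxx addr0 mulr1 => /eqP.
by rewrite mulf_eq0 sgr_eq0 (negPf C0) => /eqP.
Qed.

Lemma tprojD p x y : tproj C p (x + y) = tproj C p x + tproj C p y.
Proof. by rewrite /tproj sformDl mulrDr scalerDl opprD addrACA. Qed.

Lemma tprojZ p k x : tproj C p (k *: x) = k *: tproj C p x.
Proof. by rewrite /tproj sformZl mulrCA scalerBr scalerA. Qed.

Lemma tproj_id p x : sform C x p = 0 -> tproj C p x = x.
Proof. by rewrite /tproj => ->; rewrite mulr0 scale0r subr0. Qed.

Lemma sform_tproj p x y :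
  sform C p y = 0 -> sform C (tproj C p x) y = sform C x y.
Proof. by move=> py; rewrite /tproj sformBl sformZl py mulr0 subr0. Qed.

Lemma tproj_normal p x :
  C != 0 -> sform C p p = C^-1 -> sform C (tproj C p x) p = 0.
Proof.
by move=> C0 pp; rewrite /tproj sformBl sformZl pp mulrAC divff // mul1r subrr.
Qed.

Lemma is_derive_sform (V : normedModType R) (f g : V -> 'rV[R]_n.+1) (u v : V)
    (df dg : 'rV[R]_n.+1) :
  is_derive u v f df -> is_derive u v g dg ->
  is_derive u v (fun t : V => sform C (f t) (g t))
    (sform C df (g u) + sform C (f u) dg).
Proof.
have coord (F : V -> 'rV[R]_n.+1) (dF : 'rV[R]_n.+1) j : is_derive u v F dF ->
    is_derive u v (fun t : V => F t ord0 j) (dF ord0 j).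
  move=> [Fd <-]; rewrite derive_mx // mxE.
  exact/derivableP/(derivable_mxP _ _ _).1.
move=> fD gD; rewrite /sform.
have -> : (fun t : V => Num.sg C * (f t ord0 ord0 * g t ord0 ord0) +
      \sum_(j < n) f t ord0 (lift ord0 j) * g t ord0 (lift ord0 j)) =
    Num.sg C *: ((fun t : V => f t ord0 ord0) * (fun t : V => g t ord0 ord0)) +
      \sum_(j < n) ((fun t : V => f t ord0 (lift ord0 j)) *
                    (fun t : V => g t ord0 (lift ord0 j))).
  by apply/funext => t; rewrite /= [in RHS]fctE fct_sumE.
have H j := is_deriveM (coord _ _ j fD) (coord _ _ j gD).
apply: (is_derive_eq (is_deriveD (is_deriveZ _ (H ord0))
  (is_derive_sum (fun j => H (lift ord0 j))))).
rewrite /GRing.scale /= addrACA -mulrDr -big_split /=.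
congr (_ * _ + _); first by rewrite addrC mulrC; congr (_ + _); rewrite mulrC.
by apply: eq_bigr => j _; rewrite addrC mulrC; congr (_ + _); rewrite mulrC.
Qed.

End Sform.

Lemma is_derive_scale (R : realType) (V : normedModType R) n
    (a : V -> R) (f : V -> 'rV[R]_n) (u v : V) (da : R) (df : 'rV[R]_n) :
  is_derive u v a da -> is_derive u v f df ->
  is_derive u v (fun y => a y *: f y) (a u *: df + da *: f u).
Proof.
move=> aD [fd <-].
have coord i j : is_derive u v (fun y => (a y *: f y) i j)
    (a u * ('D_v f u) i j + da * f u i j).
  rewrite derive_mx // mxE.
  have -> : (fun y => (a y *: f y) i j) = a * (fun y => f y i j).
    by apply/funext => y; rewrite mxE.
  apply: is_derive_eq.
    by apply: is_deriveM; exact/derivableP/(derivable_mxP _ _ _).1.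
  by congr (_ + _); exact: mulrC.
have dd : derivable (fun y => a y *: f y) u v.
  by apply/derivable_mxP => i j; have [] := coord i j.
apply: DeriveDef => //; rewrite derive_mx //; apply/matrixP => i j.
by rewrite !mxE (@derive_val _ _ _ _ _ _ _ (coord i j)).
Qed.

(** The vectors [p], [N] and the images under [L] of the standard basis are [n.+2] independent
    vectors, hence a basis, and [x] is orthogonal to all of them. The form may be indefinite, so [p]
    and [N] are required to be non-null instead of positive. *)
Lemma sform_span0 (R : realType) n (C : R) (L : {linear 'rV[R]_n -> 'rV[R]_n.+2})
    (p N x : 'rV[R]_n.+2) :
  C != 0 -> (forall xi, L xi = 0 -> xi = 0) ->
  sform C p p != 0 -> sform C N N != 0 -> sform C p N = 0 ->
  (forall xi, sform C p (L xi) = 0) -> (forall xi, sform C N (L xi) = 0) ->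
  sform C x p = 0 -> sform C x N = 0 -> (forall xi, sform C x (L xi) = 0) ->
  x = 0.
Proof.
move=> C0 Linj pp NN pN pL NL xp xN xL.
pose A := col_mx (col_mx p N) (lin1_mx L).
have AE (c : 'rV[R]_(1 + 1 + n)) : c *m A =
    lsubmx (lsubmx c) 0 0 *: p + rsubmx (lsubmx c) 0 0 *: N + L (rsubmx c).
  rewrite -{1}[c]hsubmxK -{1}[lsubmx c]hsubmxK !mul_row_col mul_rV_lin1.
  by rewrite [lsubmx (lsubmx c)]mx11_scalar [rsubmx (lsubmx c)]mx11_scalar
    !mul_scalar_mx !mxE.
have Afree : row_free A.
  apply/inj_row_free => c; rewrite AE => c0.
  (* Pairing a linear relation with [p], then with [N], isolates their coefficients by
     orthogonality; injectivity of [L] disposes of the rest. *)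
  have a0 : lsubmx (lsubmx c) 0 0 = 0.
    apply/(mulIf pp); rewrite mul0r -sformZr.
    have := congr1 (sform C p) c0.
    rewrite !sformDr pL [X in _ + X + _]sformZr pN mulr0 !addr0 => ->.
    by rewrite -(scale0r p) sformZr mul0r.
  have b0 : rsubmx (lsubmx c) 0 0 = 0.
    apply/(mulIf NN); rewrite mul0r -sformZr.
    have := congr1 (sform C N) c0; rewrite a0 scale0r add0r sformDr NL addr0 => ->.
    by rewrite -(scale0r p) sformZr mul0r.
  move: c0; rewrite a0 b0 !scale0r !add0r => /Linj r0.
  rewrite -[c]hsubmxK -[lsubmx c]hsubmxK r0 [lsubmx (lsubmx c)]mx11_scalar.
  by rewrite [rsubmx (lsubmx c)]mx11_scalar a0 b0 !raddf0 !row_mx0.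
apply: (sform_nondegenerate C0) => y.
(* The matrix [A] is square, as [1 + 1 + n] and [n.+2] are convertible, so independence of its rows
   also says that they span. *)
have /submxP [c ->] : (y <= A)%MS by apply: submx_full; exact: Afree.
by rewrite AE !sformDr !sformZr xp xN xL !mulr0 !addr0.
Qed.

(** * Chain rules, a linear differential equation, covariant derivatives along maps *)

Lemma is_derive_comp (R : realType) (U V W : normedModType R) (f : U -> V)
    (g : V -> W) (x v : U) :
  differentiable f x -> differentiable g (f x) ->
  is_derive x v (g \o f) ('D_('D_v f x) g (f x)).
Proof.
move=> fd gd; have gfd := differentiable_comp fd gd.
apply: DeriveDef; first exact: diff_derivable.
by rewrite !deriveE // diff_comp.
Qed.

Lemma derive1_scale (R : realType) (W : normedModType R) (f : R -> W) (t v : R) :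
  derivable f t 1 -> is_derive t v f (v *: derive1 f t).
Proof.
move=> fd; have fD : differentiable f t by apply/derivable1_diffP.
apply: DeriveDef; first exact: diff_derivable.
by rewrite derive1E !deriveE // -linearZ /= -[v *: 1]/(v * 1) mulr1.
Qed.

(** The equation f'' = k f closes the span of f and f' under differentiation, so on [I] every
    iterated derivative is a differentiable combination of these two. *)
Lemma smooth_on_linear_ode (R : realType) (W : normedModType R) (I : set R)
    (f : R -> W) (k : R) :
  open I -> (forall t, I t -> derivable f t 1) ->
  (forall t, I t -> derivable (derive1 f) t 1) ->
  (forall t, I t -> derive1 (derive1 f) t = k *: f t) -> smooth_on I f.
Proof.
move=> oI f1 f2 fk s.
have sD (a b v t : R) : I t -> is_derive t v (a *: f + b *: derive1 f)
    ((v * (b * k)) *: f t + (v * a) *: derive1 f t).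
  move=> It; apply: is_derive_eq.
    by apply: is_deriveD; apply: is_deriveZ; apply: derive1_scale; auto.
  by rewrite fk // !scalerA addrC; congr (_ *: _ + _ *: _); ring.
have [a [b ab]] : exists a b : R, forall t, I t ->
    iterated_derive f s t = (a *: f + b *: derive1 f) t.
  elim: s => [|v s [a [b ab]]].
    by exists 1, 0 => t _; rewrite !fctE scale1r scale0r addr0.
  (* On the real line the direction [v] is a scalar factor: the derivative of a f + b f' along [v]
     is v (a f' + b f''), and f'' = k f. *)
  exists (v * (b * k)), (v * a) => t It /=.
  apply: etrans (@derive_val _ _ _ _ _ _ _ (sD a b v t It)).
  by apply: near_eq_derive; apply: filterS (near_open oI It) => y /ab.
move=> t It; apply/derivable1_diffP.
have [dd _] := sD a b 1 t It; apply: near_eq_derivable dd.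
by apply: filterS (near_open oI It) => y /ab ->.
Qed.

(** A map [psi] with values in the space form sees no difference between [V] and the local extension
    [g], so [V \o psi] inherits the derivative of [g \o psi] given by the chain rule. *)
Lemma is_derive_cov (R : realType) (n : nat) (C : R) (W : normedModType R)
    (V : 'rV[R]_n.+1 -> 'rV[R]_n.+1) (psi : W -> 'rV[R]_n.+1) (u v : W) Y :
  differentiable psi u -> (\forall y \near u, space_form C (psi y)) ->
  is_cov_derive C V (psi u) ('D_v psi u) Y ->
  exists2 Z, is_derive u v (V \o psi) Z & tproj C (psi u) Z = Y.
Proof.
move=> psid psiM [g [G [oG Gu gs gV]] gY].
exists ('D_('D_v psi u) g (psi u)) => //.
have gd : differentiable g (psi u) by exact: (gs [::]).
have : is_derive u v (g \o psi) ('D_('D_v psi u) g (psi u)).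
  exact: is_derive_comp.
apply: near_eq_is_derive.
have Gn : \forall y \near u, G (psi y).
  exact: (differentiable_continuous psid (near_open oG Gu)).
by near=> y => /=; apply: gV; near: y.
Unshelve. all: by end_near. Qed.

Lemma near_cst_is_derive (R : realType) (V W : normedModType R) (f : V -> W)
    (k df : W) (u v : V) :
  is_derive u v f df -> (\forall y \near u, f y = k) -> df = 0.
Proof.
move=> fD fk; rewrite -(@derive_val _ _ _ _ _ _ _ fD).
by rewrite (near_eq_derive (g := cst k)) ?derive_cst.
Qed.

Lemma cst_is_derive (R : realType) (V W : normedModType R) (f : V -> W)
    (k df : W) (u v : V) :
  is_derive u v f df -> (forall y, f y = k) -> df = 0.
Proof.
by move=> fD fk; apply: near_cst_is_derive fD _; apply: nearW; exact: fk.
Qed.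

(** * Tangent vectors and the shape operator in a parametrization *)

Section Hypersurface.
Context {R : realType} {n : nat} {C : R} {M : topologicalType}
  {i : M -> 'rV[R]_n.+1}.

(** Differentiate the constant <f, f> = 1/C. *)
Lemma sform_derive_tangent (V : normedModType R) (f : V -> 'rV[R]_n.+1) u v :
  differentiable f u -> (\forall y \near u, space_form C (f y)) ->
  sform C (f u) ('D_v f u) = 0.
Proof.
move=> fd fM; have fD : is_derive u v f ('D_v f u).
  exact/derivableP/diff_derivable.
have pp : \forall y \near u, sform C (f y) (f y) = C^-1.
  by apply: filterS fM => y [].
have := near_cst_is_derive (is_derive_sform C fD fD) pp.
by rewrite sformC -mulr2n => /eqP; rewrite mulrn_eq0 /= => /eqP.
Qed.

(** Differentiating <D_a f, N> = 0 along b, with f = [i \o phi], gives <D_b D_a f, N> = - <D_a f,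
    D_b N>, whose left side is symmetric in a and b. Flat derivatives of [N] can replace the shape
    operator up to sign: they differ from their projections by multiples of the position vector,
    which is orthogonal to tangent vectors. *)
Lemma shape_selfadjoint (N : M -> 'rV[R]_n.+1) U phi u xi eta :
  parametrization i U phi -> unit_normal C i N -> U u ->
  sform C ('D_eta (i \o phi) u) ('D_xi (N \o phi) u) =
  sform C ('D_xi (i \o phi) u) ('D_eta (N \o phi) u).
Proof.
move=> P [Ns _ Nn _] Uu; have [oU _ _ fs _] := P.
have key a b : sform C ('D_b ('D_a (i \o phi)) u) (N (phi u)) =
    - sform C ('D_a (i \o phi) u) ('D_b (N \o phi) u).
  have fD : is_derive u b ('D_a (i \o phi)) ('D_b ('D_a (i \o phi)) u).
    by apply/derivableP/diff_derivable; exact: (fs [:: a]).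
  have ND : is_derive u b (N \o phi) ('D_b (N \o phi) u).
    by apply/derivableP/diff_derivable; exact: (Ns _ _ P [::]).
  have Nf0 : \forall y \near u, sform C ('D_a (i \o phi) y) ((N \o phi) y) = 0.
    apply: filterS (near_open oU Uu) => y Uy.
    by rewrite sformC; apply: Nn; exists U, phi, y, a.
  apply/eqP; rewrite -addr_eq0; apply/eqP.
  exact: near_cst_is_derive (is_derive_sform C fD ND) Nf0.
have comm := smooth_derive_comm eta xi oU fs Uu.
apply: oppr_inj; apply: etrans (esym (key eta xi)) _.
exact: etrans (congr1 (fun w => sform C w (N (phi u))) comm) (key xi eta).
Qed.

End Hypersurface.

(** * Geodesics along the concircular axis *)

Theorem proposition5 (R : realType) (n : nat) (C : R)
    (M : topologicalType) (i : M -> 'rV[R]_n.+1)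
    (N : M -> 'rV[R]_n.+1) (V : 'rV[R]_n.+1 -> 'rV[R]_n.+1)
    (T : M -> 'rV[R]_n.+1) (alpha : M -> R) (lambda : R) :
  (2 <= n)%N -> C != 0 ->
  concircular_hypersurface C i N V ->
  ~ totally_umbilical C i N ->
  (forall m, sform C (V (i m)) (N m) = lambda) ->
  smooth_map i T ->
  (forall m, tangent_at i m (T m)) ->
  (forall m, sform C (T m) (T m) = 1) ->
  smooth_map i alpha ->
  (forall m, alpha m != 0) ->
  (forall m, V (i m) = alpha m *: T m + lambda *: N m) ->
  forall (I : set R) (gamma : R -> M),
    integral_curve i T I gamma -> geodesic C I (i \o gamma).
Proof.
(* Replacing [n] by [n.+1] turns the parameter space into ['rV_n] and the ambient space into
   ['rV_n.+2], the dimensions of [sform_span0]. *)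
case: n i N V T => // n i N V T _ C0 [[_ _ iM _] Nun [_ _ [mu _ Vcov]] _] _ VN
  Ts _ TT als al0 VE I gamma [oI _ gI].
have [Ns Nt Nn NN] := Nun.
(* The second half is nabla_T T = 0 at gamma t, phrased through the derivative of [T \o gamma]; it
   is computed at [u] in a parametrization, along the coordinate velocity [xi] of gamma. *)
have key t : I t -> is_derive t 1 (i \o gamma) (T (gamma t)) /\
    exists2 W, is_derive t 1 (T \o gamma) W & tproj C (i (gamma t)) W = 0.
  move=> It; have [[U [phi [c [P Uc cd gphi]]]] gT] := gI t It.
  have [oU _ _ fs imm] := P.
  set u := c t in Uc *; set xi := 'D_1 c t.
  have gt : gamma t = phi u by exact: nbhs_singleton gphi.
  have curve (W : normedModType R) (F : M -> W) :
      differentiable (F \o phi) u ->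
      is_derive t 1 (F \o gamma) ('D_xi (F \o phi) u).
    move=> Fd; have cdiff : differentiable c t by apply/derivable1_diffP.
    apply: near_eq_is_derive (is_derive_comp _ cdiff Fd).
    by apply: filterS gphi => s /= ->.
  have smoothD (W : normedModType R) (F : M -> W) eta : smooth_on U (F \o phi) ->
      is_derive u eta (F \o phi) ('D_eta (F \o phi) u).
    by move=> Fs; apply/derivableP/diff_derivable; exact: (Fs [::]).
  have fd : differentiable (i \o phi) u := fs [::] u Uc.
  have Td : differentiable (T \o phi) u := Ts _ _ P [::] u Uc.
  have fD := curve _ _ fd.
  have TD := curve _ _ Td.
  have Tu : 'D_xi (i \o phi) u = T (phi u).
    by rewrite -gt -gT derive1E (@derive_val _ _ _ _ _ _ _ fD).
  split; first by rewrite gt -Tu.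
  exists ('D_xi (T \o phi) u) => //; rewrite gt; set W := 'D_xi (T \o phi) u.
  set p := i (phi u).
  have fM : \forall y \near u, space_form C ((i \o phi) y).
    exact: (@filterE _ (nbhs u) _ _ (fun y => iM (phi y))).
  have ptan eta : sform C p ('D_eta (i \o phi) u) = 0.
    exact: (sform_derive_tangent _ fd fM).
  have pp : sform C p p = C^-1 by have [] := iM (phi u).
  have pN : sform C p (N (phi u)) = 0 := Nt _.
  have Ntan eta : sform C (N (phi u)) ('D_eta (i \o phi) u) = 0.
    by apply: Nn; exists U, phi, u, eta.
  have unit_orth (F : M -> 'rV[R]_n.+2) eta : smooth_on U (F \o phi) ->
      (forall m, sform C (F m) (F m) = 1) ->
      sform C (F (phi u)) ('D_eta (F \o phi) u) = 0.
    move=> Fs F1; have D := smoothD _ _ eta Fs.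
    have := cst_is_derive (is_derive_sform C D D) (fun y => F1 (phi y)).
    by rewrite sformC -mulr2n => /eqP; rewrite mulrn_eq0 /= => /eqP.
  have ND eta := smoothD _ _ eta (Ns _ _ P).
  have AT eta : sform C (T (phi u)) ('D_eta (N \o phi) u) = 0.
    have [Z ZD pZ] := is_derive_cov fd fM (Vcov p _ (iM _) (ptan eta)).
    have := cst_is_derive (is_derive_sform C ZD (ND eta))
      (fun y => VN (phi y)).
    (* As [N] is orthogonal to [p], the derivative [Z] of [V] may be projected to mu X, which [N]
       annihilates. In the remaining <V, D N> the [lambda] term drops because [N] has unit length,
       and [alpha] cancels. *)
    rewrite -(@sform_tproj _ _ C p) // pZ sformZl sformC Ntan mulr0 add0r /= VE.
    rewrite sformDl !sformZl (unit_orth N) ?mulr0 ?addr0; [|exact: Ns|exact: NN].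
    by move=> /eqP; rewrite mulf_eq0 (negPf (al0 _)) => /eqP.
  have A0 : tproj C p ('D_xi (N \o phi) u) = 0.
    have LE eta : 'd (i \o phi) u eta = 'D_eta (i \o phi) u by rewrite deriveE.
    apply: (sform_span0 (L := 'd (i \o phi) u) (p := p) (N := N (phi u)) C0).
    - by move=> eta; rewrite LE; exact: imm.
    - by rewrite pp invr_eq0.
    - by rewrite NN oner_eq0.
    - by [].
    - by move=> eta; rewrite LE.
    - by move=> eta; rewrite LE.
    - exact: tproj_normal.
    - by rewrite sform_tproj // sformC unit_orth //; exact: Ns.
    (* Self-adjointness trades <A T, X> for <T, A X>, which is zero by [AT]. *)
    - move=> eta; rewrite LE sform_tproj // sformC.
      by rewrite (shape_selfadjoint _ _ P Nun Uc) Tu AT.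
  have [Z ZD pZ] := is_derive_cov fd fM (Vcov p _ (iM _) (ptan xi)).
  have aD := smoothD _ _ xi (als _ _ P).
  have VfE : V \o (i \o phi) =
      (fun y => alpha (phi y) *: T (phi y)) + lambda *: (N \o phi).
    by apply/funext => y; rewrite /= VE.
  have VfD : is_derive u xi (V \o (i \o phi)) (alpha (phi u) *: W +
      'D_xi (alpha \o phi) u *: T (phi u) + lambda *: 'D_xi (N \o phi) u).
    have TD' := smoothD _ _ xi (Ts _ _ P).
    have aTD := is_derive_scale aD TD'.
    by rewrite VfE; exact: (is_deriveD aTD (is_deriveZ lambda (ND xi))).
  (* Uniqueness of the derivative equates the two computations for [V] along [T]: the concircular
     one and the one from the decomposition. *)
  have ZE := etrans (esym (@derive_val _ _ _ _ _ _ _ ZD))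
    (@derive_val _ _ _ _ _ _ _ VfD).
  move: pZ; rewrite ZE Tu !tprojD !tprojZ A0 scaler0 addr0.
  rewrite [tproj C p (T _)]tproj_id; last by rewrite sformC -Tu.
  have TW : sform C (tproj C p W) (T (phi u)) = 0.
    by rewrite sform_tproj -?Tu // Tu sformC (unit_orth T) //; exact: Ts.
  (* Pairing with [T] gives T(alpha) = mu, so the terms in [T] cancel and [alpha] times the
     projection of [W] is zero. *)
  move=> E; have := congr1 (sform C ^~ (T (phi u))) E.
  rewrite /= sformDl !sformZl TW TT mulr0 add0r !mulr1 => Emu.
  move: E; rewrite Emu -[X in _ = X]add0r => /addIr /eqP.
  by rewrite scaler_eq0 (negPf (al0 _)) => /eqP.
have d1 t : I t -> derive1 (i \o gamma) t = T (gamma t).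
  by move=> /gI [].
have near_d1 t : I t -> \forall s \near t, T (gamma s) = derive1 (i \o gamma) s.
  by move=> It; apply: filterS (near_open oI It) => s /d1 ->.
have d2 t : I t -> is_derive t 1 (derive1 (i \o gamma)) (- C *: i (gamma t)).
  move=> It; have [iD [W WD pW]] := key t It.
  suff <- : W = - C *: i (gamma t) by exact: near_eq_is_derive (near_d1 t It) WD.
  (* Differentiating <T, c> = 0 along the curve c gives <W, c> = - <T, T> = -1, so the vanishing of
     W - C <W, c> c reads W = - C c. *)
  have Tp : \forall s \near t, sform C ((T \o gamma) s) ((i \o gamma) s) = 0.
    apply: filterS (near_open oI It) => s Is /=.
    have [[idf <-] _] := key s Is; rewrite sformC.
    apply: (sform_derive_tangent (f := i \o gamma)); first exact/derivable1_diffP.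
    exact: (@filterE _ (nbhs s) _ _ (fun r => iM (gamma r))).
  have := near_cst_is_derive (is_derive_sform C WD iD) Tp.
  rewrite /= TT => /eqP; rewrite addr_eq0 => /eqP WT.
  by move/eqP: pW; rewrite /tproj WT mulrN1 subr_eq0 => /eqP.
have d2E t : I t -> derive1 (derive1 (i \o gamma)) t = - C *: i (gamma t).
  by move=> /d2 d2t; rewrite derive1E (@derive_val _ _ _ _ _ _ _ d2t).
split => [|t It|t It]; first last.
- have [_ [W WD pW]] := key t It; rewrite -[RHS]pW; congr tproj.
  have WD' := near_eq_is_derive (near_d1 t It) WD.
  by rewrite derive1E (@derive_val _ _ _ _ _ _ _ WD').
- exact: iM.
apply: (smooth_on_linear_ode (k := - C) oI) => t It //.
- by have [[]] := key t It.
- by have [] := d2 t It.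
- exact: d2E.
Qed.
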